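(* Let $I\ge 2$, $M>3$, $R\ge 1$ be integers and let $\mathcal{M}_1,\mathcal{M}_2,\mathcal{M}_3$ be pairwise disjoint nonempty subsets of $\{1,\dots,M\}$ with $\mathcal{M}_1\cup\mathcal{M}_2\cup\mathcal{M}_3=\{1,\dots,M\}$, of cardinalities $M_1,M_2,M_3$. Let $\mathcal{T}=\mathcal{M}_1\times\mathcal{M}_2\times\mathcal{M}_3$ be the Cartesian coupling, i.e. $\mathcal{T}=\{\{j,k,\ell\}: j\in\mathcal{M}_1,k\in\mathcal{M}_2,\ell\in\mathcal{M}_3\}$. Suppose that the real rank-$R$ CP model for tensors of size $((I-1)M_1+1)\times((I-1)M_2+1)\times((I-1)M_3+1)$ is identifiable (generically unique). Then the rank-$R$ PCTF3D model $(\mu,\Theta)$ for the coupling $\mathcal{T}$ is identifiable.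
   Context: Real rank-$R$ CP model for $I_1\times I_2\times I_3$ tensors: the map $(\boldsymbol\lambda,\mathbf{A},\mathbf{B},\mathbf{C})\mapsto\sum_{r=1}^R\lambda_r\mathbf{a}_r\circ\mathbf{b}_r\circ\mathbf{c}_r$ with $\mathbf{A}\in\mathbb{R}^{I_1\times R}$ etc.; it is identifiable (generically unique) if, for all parameters outside a Lebesgue-null set, every other $R$-term decomposition of the same tensor is obtained by permuting the rank-one terms and rescaling factors within a term. PCTF3D model: a coupling $\mathcal{T}$ is a set of $T$ three-element subsets (triplets) of $\{1,\dots,M\}$. Parameters $\theta=(\theta_1,\dots,\theta_R)$ with $\theta_r=(\lambda_r,\mathbf{a}^{(1)}_r,\dots,\mathbf{a}^{(M)}_r)\in\mathbb{R}\times(\mathbb{R}^I)^M$. The map $\mu:\mathbb{R}^{R(IM+1)}\to\mathbb{R}^{TI^3}$ sends $\theta$ to the tuple, over triplets $\{j,k,\ell\}\in\mathcal{T}$ (with $j<k<\ell$, in a fixed order), of the vectorized tensors $\mathcal{H}^{(jk\ell)}=\sum_{r=1}^R\lambda_r\,\mathbf{a}^{(j)}_r\circ\mathbf{a}^{(k)}_r\circ\mathbf{a}^{(\ell)}_r\in\mathbb{R}^{I\times I\times I}$ (these are the 3D marginals of $\mathcal{H}=\sum_r\lambda_r\mathbf{a}^{(1)}_r\circ\cdots\circ\mathbf{a}^{(M)}_r$). The constraint set is $\Theta=\{\theta:\lambda_r\ge0,\ \sum_r\lambda_r=1,\ \mathbf{a}^{(m)}_r\ge0,\ \mathbf{1}_I^T\mathbf{a}^{(m)}_r=1\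 \forall r,m\}$. The model $(\mu,\Theta)$ is identifiable if for generic $\theta\in\Theta$ (all except a subset of $\Theta$ of measure zero with respect to Lebesgue measure on the affine hull of $\Theta$), every $\theta'\in\Theta$ with $\mu(\theta')=\mu(\theta)$ is obtained from $\theta$ by a permutation of the blocks $\theta_1,\dots,\theta_R$. *)

(* Defs.v *)
From HB Require Import structures.
From mathcomp Require Import all_boot all_order all_algebra all_fingroup.
From mathcomp Require Import reals.
Set Implicit Arguments. Unset Strict Implicit. Unset Printing Implicit Defensive.
Import Order.TTheory GRing.Theory Num.Theory.
Local Open Scope ring_scope.

Definition lnull (R : realType) (D : finType) (N : (D -> R) -> Prop) : Prop :=
  forall eps : R, 0 < eps ->
  exists lo hi : nat -> D -> R,
    (forall k d, lo k d <= hi k d) /\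
    (forall x, N x -> exists k, forall d, lo k d <= x d <= hi k d) /\
    (forall n : nat, \sum_(k < n) \prod_(d : D) (hi k d - lo k d) <= eps).

Definition cp_tensor (R : realType) (I1 I2 I3 rk : nat)
  (lam : 'I_rk -> R) (A : 'I_I1 -> 'I_rk -> R) (B : 'I_I2 -> 'I_rk -> R)
  (C : 'I_I3 -> 'I_rk -> R) (i1 : 'I_I1) (i2 : 'I_I2) (i3 : 'I_I3) : R :=
  \sum_(r < rk) lam r * A i1 r * B i2 r * C i3 r.

Definition cp_coord (I1 I2 I3 rk : nat) : finType :=
  ('I_rk + ('I_I1 * 'I_rk + ('I_I2 * 'I_rk + 'I_I3 * 'I_rk)))%type.

Definition cp_encode (R : realType) (I1 I2 I3 rk : nat)
  (lam : 'I_rk -> R) (A : 'I_I1 -> 'I_rk -> R) (B : 'I_I2 -> 'I_rk -> R)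
  (C : 'I_I3 -> 'I_rk -> R) : cp_coord I1 I2 I3 rk -> R :=
  fun d => match d with
  | inl r => lam r
  | inr (inl (i, r)) => A i r
  | inr (inr (inl (i, r))) => B i r
  | inr (inr (inr (i, r))) => C i r
  end.

Definition cp_trivially_related (R : realType) (I1 I2 I3 rk : nat)
  (lam : 'I_rk -> R) (A : 'I_I1 -> 'I_rk -> R) (B : 'I_I2 -> 'I_rk -> R)
  (C : 'I_I3 -> 'I_rk -> R)
  (lam' : 'I_rk -> R) (A' : 'I_I1 -> 'I_rk -> R) (B' : 'I_I2 -> 'I_rk -> R)
  (C' : 'I_I3 -> 'I_rk -> R) : Prop :=
  exists (s : {perm 'I_rk}) (c0 c1 c2 c3 : 'I_rk -> R),
    forall r : 'I_rk,
      c0 r * c1 r * c2 r * c3 r = 1 /\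
      lam' (s r) = c0 r * lam r /\
      (forall i, A' i (s r) = c1 r * A i r) /\
      (forall i, B' i (s r) = c2 r * B i r) /\
      (forall i, C' i (s r) = c3 r * C i r).

Definition cp_identifiable (R : realType) (I1 I2 I3 rk : nat) : Prop :=
  exists N : (cp_coord I1 I2 I3 rk -> R) -> Prop,
    lnull N /\
    forall lam A B C, ~ N (cp_encode lam A B C) ->
    forall lam' A' B' C',
      (forall i1 i2 i3, cp_tensor lam' A' B' C' i1 i2 i3
                        = cp_tensor lam A B C i1 i2 i3) ->
      cp_trivially_related lam A B C lam' A' B' C'.

(* PCTF3D model.  Modes are indexed by 'I_M (0-based), rank-one terms by *)
(* 'I_rk, and entries of the factor vectors by 'I_I.  A parameter theta  *)
(* is a pair (lam, a) with lam r = lambda_r and a m r i = (a^(m)_r)_i.   *)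

(* The 3D marginal H^(jkl) for a triplet S = {j,k,l}, j<k<l            *)
(* (enum S lists the elements of S in increasing order).                *)
Definition pctf_marginal (R : realType) (I M rk : nat)
  (lam : 'I_rk -> R) (a : 'I_M -> 'I_rk -> 'I_I -> R) (S : {set 'I_M})
  (i1 i2 i3 : 'I_I) : R :=
  match enum S with
  | [:: j; k; l] => \sum_(r < rk) lam r * a j r i1 * a k r i2 * a l r i3
  | _ => 0
  end.

Definition pctf_same_image (R : realType) (I M rk : nat) (T : {set {set 'I_M}})
  (lam : 'I_rk -> R) (a : 'I_M -> 'I_rk -> 'I_I -> R)
  (lam' : 'I_rk -> R) (a' : 'I_M -> 'I_rk -> 'I_I -> R) : Prop :=
  forall S, S \in T -> forall i1 i2 i3,
    pctf_marginal lam' a' S i1 i2 i3 = pctf_marginal lam a S i1 i2 i3.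

Definition in_Theta (R : realType) (I M rk : nat)
  (lam : 'I_rk -> R) (a : 'I_M -> 'I_rk -> 'I_I -> R) : Prop :=
  (forall r, 0 <= lam r) /\ \sum_(r < rk) lam r = 1 /\
  (forall m r i, 0 <= a m r i) /\ (forall m r, \sum_(i < I) a m r i = 1).

(* Affine coordinates on the affine hull of Theta: drop the last entry   *)
(* of lambda and the last entry of every a^(m)_r.  On the affine hull   *)
(* this is an affine bijection onto R^((rk-1) + M rk (I-1)).            *)
Definition pctf_coord (I M rk : nat) : finType :=
  ('I_rk.-1 + ('I_M * 'I_rk * 'I_I.-1))%type.

Definition pctf_proj (R : realType) (I M rk : nat)
  (lam : 'I_rk -> R) (a : 'I_M -> 'I_rk -> 'I_I -> R) :
  pctf_coord I M rk -> R :=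
  fun d => match d with
  | inl r => lam (widen_ord (leq_pred rk) r)
  | inr (m, r, i) => a m r (widen_ord (leq_pred I) i)
  end.

Definition pctf_identifiable (R : realType) (I M rk : nat)
  (T : {set {set 'I_M}}) : Prop :=
  exists N : (pctf_coord I M rk -> R) -> Prop,
    lnull N /\
    forall lam a, in_Theta lam a -> ~ N (pctf_proj lam a) ->
    forall lam' a', in_Theta lam' a' ->
      pctf_same_image T lam a lam' a' ->
      exists s : {perm 'I_rk}, forall r : 'I_rk,
        lam' r = lam (s r) /\ forall m i, a' m r i = a m (s r) i.

Definition cartesian_coupling (M : nat) (M1 M2 M3 : {set 'I_M})
  : {set {set 'I_M}} :=
  [set S : {set 'I_M} |
     [exists j in M1, exists k in M2, exists l in M3, S == [set j; k; l]]].

(* Main.v *)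
Require Import Defs.
From HB Require Import structures.
From mathcomp Require Import boolp classical_sets functions reals ereal topology.
From mathcomp Require Import normedtype sequences measure lebesgue_measure numfun.
From mathcomp Require Import lebesgue_integral measurable_realfun.
From mathcomp Require Import all_boot all_order all_algebra all_fingroup.
From mathcomp Require Import reals ring lra.
Import Order.TTheory GRing.Theory Num.Theory.
Local Open Scope ring_scope.

(** Stacking the free entries of the factors of the modes in each class, and
    appending a row of ones, turns the coupled marginals into one CP tensor whose
    factors have last rows equal to 1 and whose weights sum to 1.  Such normalised
    parameters form a null set, so CP identifiability cannot be applied to them
    directly.  Instead, Fubini yields positive values [alpha_r], [beta_r],
    [gamma_r] of the last rows, and then a value [tau] of the linear form
    [\sum_r alpha_r beta_r gamma_r lambda_r], such that the corresponding slice of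
    the exceptional null set is still null.  With these numbers fixed, a diagonal
    rescaling maps the normalised parameters onto the slice without changing
    the tensor, up to the factor [tau]. *)

(** * Boxes and their subdivision into near-cubes *)

Section Boxes.
Context {R : realType} {D : finType}.
Implicit Types (P : {set D}) (b : {ffun D -> R * R}) (s : seq {ffun D -> R * R})
  (x : D -> R) (Q : {ffun D -> R * R} -> Prop).

Definition box_width b d : R := (b d).2 - (b d).1.
(** Only the sides in [P] count, so a single type of boxes serves every coordinate subspace, and
    projecting along a coordinate just shrinks [P]. *)
Definition box_vol P b : R := \prod_(d in P) box_width b d.
Definition in_box P b x := forall d, d \in P -> (b d).1 <= x d <= (b d).2.
Definition box_ok b := forall d, (b d).1 <= (b d).2.
Definition set_side b d (p : R * R) : {ffun D -> R * R} :=
  [ffun e => if e == d then p else b e].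

Lemma box_width_ge0 b d : box_ok b -> 0 <= box_width b d.
Proof. by move=> ok; rewrite subr_ge0. Qed.

Lemma box_vol_ge0 P b : box_ok b -> 0 <= box_vol P b.
Proof. by move=> ok; apply: prodr_ge0 => d _; apply: box_width_ge0. Qed.

Lemma set_side_ok b d p : box_ok b -> p.1 <= p.2 -> box_ok (set_side b d p).
Proof. by move=> ok ple e; rewrite ffunE; case: eqP. Qed.

Lemma box_vol_set_side P b d p : d \in P ->
  box_vol P (set_side b d p) = (p.2 - p.1) * box_vol (P :\ d) b.
Proof.
move=> dP; rewrite /box_vol (big_setD1 d dP) /=.
rewrite {1}/box_width ffunE eqxx; congr (_ * _).
apply: eq_bigr => e; rewrite !inE => /andP[ed _].
by rewrite /box_width ffunE (negbTE ed).
Qed.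

Lemma box_vol_setD1 P b d : d \in P ->
  box_vol P b = box_width b d * box_vol (P :\ d) b.
Proof. by move=> dP; rewrite /box_vol (big_setD1 d dP). Qed.

(** [Q] is the shape demanded of the new boxes. The slack [eta] pays for thickening degenerate
    boxes, which cannot be cut into cubes at no cost. *)
Definition refined P Q s s' (eta : R) :=
  [/\ forall b, b \in s' -> box_ok b /\ Q b,
      forall x b, b \in s -> in_box P b x ->
        exists2 b', b' \in s' & in_box P b' x
    & \sum_(b <- s') box_vol P b <= \sum_(b <- s) box_vol P b + eta].

Lemma refined_trans P Q Q' s s' s'' e e' :
  refined P Q s s' e -> refined P Q' s' s'' e' -> refined P Q' s s'' (e + e').
Proof.
move=> [_ cov sum1] [ok' cov' sum2]; split=> //.
  by move=> x b bs xb; have [b1 b1s xb1] := cov _ _ bs xb; apply: cov' b1s xb1.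
by rewrite addrA; apply: le_trans sum2 _; rewrite lerD2r.
Qed.

Lemma refined_seq P Q0 Q s (eta : R) :
  (forall b (e : R), 0 < e -> box_ok b -> Q0 b ->
     exists s', refined P Q [:: b] s' e) ->
  0 < eta -> (forall b, b \in s -> box_ok b /\ Q0 b) ->
  exists s', refined P Q s s' eta.
Proof.
move=> ref1; elim: s eta => [|b s IHs] eta eta0 oks.
  by exists [::]; split=> //; rewrite !big_nil add0r ltW.
have e2 : 0 < eta / 2%:R by rewrite divr_gt0.
have [okb Qb] := oks b (mem_head _ _).
have [sb [okb' covb sumb]] := ref1 b _ e2 okb Qb.
have [|s' [ok' cov' sum']] := IHs _ e2.
  by move=> b' b's; apply: oks; rewrite inE b's orbT.
exists (sb ++ s'); split.
- by move=> c; rewrite mem_cat => /orP[/okb'|/ok'].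
- move=> x c; rewrite inE => /orP[/eqP->|cs] xc.
    have [c' c's xc'] := covb x b (mem_head _ _) xc.
    by exists c'; rewrite // mem_cat c's.
  by have [c' c's xc'] := cov' x c cs xc; exists c'; rewrite // mem_cat c's orbT.
- by rewrite big_cat big_cons /=; move: sumb sum'; rewrite big_seq1; lra.
Qed.

(** Positive width along [d0] is what later allows the other sides to be cut into finitely many
    pieces no longer than it. *)
Lemma refined_fatten P d0 b (eta : R) : d0 \in P -> 0 < eta -> box_ok b ->
  exists s, refined P (fun b' => 0 < box_width b' d0) [:: b] s eta.
Proof.
move=> d0P eta0 okb.
have v0 := box_vol_ge0 (P :\ d0) b okb.
set v := box_vol (P :\ d0) b in v0.
have v10 : 0 < 1 + v by lra.
(* The added volume is [dl * v], at most [eta]; the summand 1 keeps the denominator positive when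
   [v = 0]. *)
pose dl := eta / (1 + v).
have dl0 : 0 < dl by rewrite divr_gt0.
have dlE : dl * (1 + v) = eta by rewrite divfK ?gt_eqF.
have okd := okb d0.
exists [:: set_side b d0 ((b d0).1, (b d0).2 + dl)]; split.
- move=> c; rewrite inE => /eqP->; split; first by apply: set_side_ok => //=; lra.
  by rewrite /box_width ffunE eqxx /=; lra.
- move=> x c; rewrite inE => /eqP-> xb; eexists; first exact: mem_head.
  move=> d /xb; rewrite ffunE; case: eqP => [->|] //= /andP[? ?].
  by apply/andP; split; lra.
- rewrite !big_seq1 box_vol_set_side // (box_vol_setD1 P b d0 d0P) -/v /= /box_width.
  by move: dlE; rewrite mulrDr mulr1; nra.
Qed.

Lemma subinterval_cover (lo q y : R) n : lo <= y <= lo + n.+1%:R * q ->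
  exists2 i, (i < n.+1)%N & lo + i%:R * q <= y <= lo + i.+1%:R * q.
Proof.
elim: n => [|n IHn] yb; first by exists 0%N => //; rewrite mul0r addr0.
have [yle|ylt] := leP y (lo + n.+1%:R * q).
  have [|i ilt yi] := IHn; first by rewrite yle (andP yb).1.
  by exists i => //; apply: ltnW.
by exists n.+1 => //; rewrite (ltW ylt) (andP yb).2.
Qed.

(** Side [d] is cut into equal pieces, which preserves the total volume and leaves the width along
    [d0] and the directions already treated, those in [r], unchanged. *)
Lemma refined_split P d d0 (r : seq D) b (eta : R) : d \in P -> d != d0 ->
  0 < eta -> box_ok b ->
  0 < box_width b d0 /\ (forall e, e \in r -> box_width b e <= box_width b d0) ->
  exists s, refined P (fun b' => 0 < box_width b' d0 /\
     forall e, e \in d :: r -> box_width b' e <= box_width b' d0) [:: b] s eta.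
Proof.
move=> dP dd0 eta0 okb [h0 hr].
set h := box_width b d0 in h0 hr.
set w := box_width b d.
have w0 : 0 <= w by apply: box_width_ge0.
(* Since [n + 1] exceeds [w / h], the [n + 1] pieces have length at most [h]. *)
pose n := Num.truncn (w / h).
pose q := w / n.+1%:R.
have n0 : 0 < n.+1%:R :> R by rewrite ltr0n.
have q0 : 0 <= q by rewrite divr_ge0.
have qn : n.+1%:R * q = w by rewrite mulrC divfK ?gt_eqF.
have qh : q <= h.
  rewrite ler_pdivrMr // mulrC -ler_pdivrMr // ltW //.
  exact: truncnS_gt.
pose piece (i : nat) := set_side b d ((b d).1 + i%:R * q, (b d).1 + i.+1%:R * q).
have pw i e : box_width (piece i) e = if e == d then q else box_width b e.
  rewrite /box_width ffunE; case: eqP => _ //=.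
  by rewrite -natr1; ring.
exists [seq piece i | i <- iota 0 n.+1]; split.
- move=> c /mapP[i _ ->]; split.
    by apply: set_side_ok => //=; rewrite lerD2l ler_wpM2r // ler_nat.
  split=> [|e]; first by rewrite pw eq_sym (negbTE dd0).
  rewrite !pw [d0 == d]eq_sym (negbTE dd0) inE.
  by case: eqP => //= _; apply: hr.
- move=> x c; rewrite inE => /eqP-> xb.
  have /subinterval_cover[i ilt xi] : (b d).1 <= x d <= (b d).1 + n.+1%:R * q.
    by rewrite qn /w /box_width addrC subrK; apply: xb.
  exists (piece i); first by apply: map_f; rewrite mem_iota.
  by move=> e /xb; rewrite ffunE; case: eqP => [->|].
- rewrite big_map big_seq1.
  rewrite (eq_bigr (fun=> q * box_vol (P :\ d) b)); last first.
    move=> i _; rewrite box_vol_set_side //; congr (_ * _).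
    by rewrite /= -natr1; ring.
  rewrite big_const_seq count_predT size_iota -/(iter _ _ _) iter_addr_0.
  rewrite -mulr_natl mulrA qn (box_vol_setD1 P b d dP) -/w.
  by rewrite lerDl ltW.
Qed.

(** Fatten along [d0], then split along the other directions one by one. The pieces need not be true
    cubes: having no side longer than the one along [d0] is all that the slicing estimate uses. *)
Lemma refined_cube P d0 s (eta : R) : d0 \in P -> 0 < eta ->
  (forall b, b \in s -> box_ok b) ->
  exists s', refined P
    (fun b => forall d, d \in P -> box_width b d <= box_width b d0) s s' eta.
Proof.
move=> d0P eta0 oks.
suff [s' [ok' cov' sum']] : exists s', refined P (fun b => 0 < box_width b d0 /\
     forall d, d \in enum (P :\ d0) -> box_width b d <= box_width b d0) s s' eta.
  exists s'; split=> // b /ok'[okb [_ cb]]; split=> // d dP.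
  have [->//|dd0] := eqVneq d d0.
  by apply: cb; rewrite mem_enum !inE dd0.
have : forall d, d \in enum (P :\ d0) -> (d \in P) && (d != d0).
  by move=> d; rewrite mem_enum !inE andbC.
elim: (enum (P :\ d0)) eta eta0 => [|d r IHr] eta eta0 rP.
  have [|s' [ok' cov' sum']] := @refined_seq P (fun=> True) _ s _
    (fun b e e0 ok _ => refined_fatten P d0 b e d0P e0 ok) eta0.
    by move=> b bs; split; first exact: oks.
  by exists s'; split=> // b /ok'[? ?]; split=> //; split.
have e2 : 0 < eta / 2%:R by rewrite divr_gt0.
have [e er|s1 ref1] := IHr _ e2; first by apply: rP; rewrite inE er orbT.
have /andP[dP dd0] := rP d (mem_head _ _).
have [ok1 _ _] := ref1.
have [s2 ref2] := refined_seq P _ _ s1 _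
  (fun b e e0 ok h => refined_split P d d0 r b e dP dd0 e0 ok h) e2 ok1.
by exists s2; rewrite [eta](splitr eta); apply: refined_trans ref1 ref2.
Qed.

End Boxes.

(** * Averaging over a level [t] in [1, 2] *)

Lemma sum_pow_half_le1 {R : realType} n : \sum_(k < n) (2^-1 : R) ^+ k.+1 <= 1.
Proof.
suff -> : \sum_(k < n) (2^-1 : R) ^+ k.+1 = 1 - 2^-1 ^+ n.
  by rewrite lerBlDr lerDl exprn_ge0 // invr_ge0.
elim: n => [|n IHn]; first by rewrite big_ord0 expr0 subrr.
by rewrite big_ord_recr /= IHn exprS; field.
Qed.

Section Averaging.
Local Open Scope classical_set_scope.
Context {R : realType}.
Local Notation mu := (@lebesgue_measure R).

Lemma nneseries_fin_le (u : nat -> R) (c : R) : (forall k, 0 <= u k) ->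
  (forall n, \sum_(k < n) u k <= c) ->
  (\sum_(0 <= k <oo) (u k)%:E <= c%:E)%E.
Proof.
move=> u0 uc; apply: lime_le.
  by apply: is_cvg_nneseries => n _ _; rewrite lee_fin.
by apply: nearW => n; rewrite sumEFin lee_fin big_mkord.
Qed.

Lemma nneseries_fin_ge (u : nat -> R) n : (forall k, 0 <= u k) ->
  ((\sum_(k < n) u k)%:E <= \sum_(0 <= k <oo) (u k)%:E)%E.
Proof.
move=> u0; rewrite -(big_mkord xpredT u) -sumEFin.
by apply: nneseries_lim_ge => k _ _; rewrite lee_fin.
Qed.

(** By monotone convergence the double series has integral at most 1/2 over [1, 2], an interval of
    length 1, so it is below 1 at some [t]. All its terms being nonnegative, this one [t] serves
    every [j] and every partial sum. *)
Lemma exists_small_double_series (g : nat -> nat -> R -> R) (I : nat -> nat -> R) :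
  (forall j k t, 0 <= g j k t) ->
  (forall j k, measurable_fun [set: R]%classic (g j k)) ->
  (forall j k, \int[mu]_(t in `[1%R, 2%R]) (g j k t)%:E <= (I j k)%:E)%E ->
  (forall j n, \sum_(k < n) I j k <= 2^-1 ^+ j.+2) ->
  exists2 t, 1 <= t <= 2 & forall j n, \sum_(k < n) g j k t <= 1.
Proof.
move=> g0 mg gI Isum.
have I0 j k : 0 <= I j k.
  rewrite -lee_fin; apply: le_trans (gI j k).
  by apply: integral_ge0 => t _; rewrite lee_fin.
pose F t := (\sum_(0 <= j <oo) \sum_(0 <= k <oo) (g j k t)%:E)%E.
have Fj0 j t : (0 <= \sum_(0 <= k <oo) (g j k t)%:E)%E.
  by apply: nneseries_ge0 => k _ _; rewrite lee_fin.
have mEg j k : measurable_fun (`[1, 2] : set R) (fun t => (g j k t)%:E).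
  by apply/measurable_EFinP; apply: measurable_funS (mg j k).
have mFj j : measurable_fun (`[1, 2] : set R) (fun t => \sum_(0 <= k <oo) (g j k t)%:E)%E.
  by apply: ge0_emeasurable_sum => // k t _ _; rewrite lee_fin.
have intF : (\int[mu]_(t in `[1%R, 2%R]) F t <= (2^-1)%:E)%E.
  rewrite integral_nneseries //.
  apply: (@le_trans _ _ (\sum_(0 <= j <oo) (2^-1 * 2^-1 ^+ j.+1)%:E)%E); last first.
    apply: nneseries_fin_le => [j|n]; first by rewrite mulr_ge0 ?exprn_ge0 ?invr_ge0.
    by rewrite -mulr_sumr ler_piMr ?invr_ge0 // sum_pow_half_le1.
  apply: lee_nneseries => [j _ _|j _]; first exact: integral_ge0.
  rewrite integral_nneseries //; [|exact: mEg|by move=> k t _; rewrite lee_fin].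
  apply: (@le_trans _ _ (\sum_(0 <= k <oo) (I j k)%:E)%E).
    apply: lee_nneseries => [k _ _|k _ //].
    by apply: integral_ge0 => t _; rewrite lee_fin.
  by apply: nneseries_fin_le => // n; rewrite -exprS.
have [t tin Ft] : exists2 t, 1 <= t <= 2 & (F t < 1)%E.
  apply: contrapT => nex.
  suff : (1 <= \int[mu]_(t in `[1%R, 2%R]) F t)%E.
    by move=> h; have := le_trans h intF; rewrite lee_fin; lra.
  have <- : (\int[mu]_(t in `[1%R, 2%R]) (cst 1 t) = 1)%E.
    rewrite integral_cst // mul1e /= lebesgue_measure_itv /= lte_fin ifT; last by lra.
    by rewrite -EFinB; congr (_%:E); lra.
  have mF : measurable_fun (`[1, 2] : set R) F.
    by apply: ge0_emeasurable_sum => // j t _ _; apply: Fj0.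
  apply: ge0_le_integral => //.
  move=> t; rewrite /= in_itv /= => tin; rewrite leNgt; apply/negP => Ft.
  by apply: nex; exists t.
exists t => // j n; rewrite -lee_fin ltW //; apply: le_lt_trans Ft.
apply: le_trans (nneseries_fin_ge _ n (fun k => g0 j k t)) _.
have := @nneseries_lim_ge _ (fun j => \sum_(0 <= k <oo) (g j k t)%:E)%E xpredT 0%N j.+1.
move=> /(_ (fun i _ _ => Fj0 i t)); apply: le_trans.
by rewrite big_nat_recr //= leeDr // sume_ge0.
Qed.

(** An entry of [s] is a weight with the endpoints of an interval. Only an upper bound holds,
    because the intervals may stick out of [1, 2]. *)
Lemma integral_step_le (s : seq (R * (R * R))) :
  (forall p, p \in s -> 0 <= p.1 /\ p.2.1 <= p.2.2) ->
  (\int[mu]_(t in `[1%R, 2%R]) (\sum_(p <- s) p.1 * \1_(`[p.2.1, p.2.2]) t)%:E <=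
    (\sum_(p <- s) p.1 * (p.2.2 - p.2.1))%:E)%E.
Proof.
elim: s => [|p s IHs] hs.
  under eq_integral do rewrite big_nil.
  by rewrite lebesgue_integral_definition.integral0 big_nil.
have [p0 ple] := hs p (mem_head _ _).
have {}hs q : q \in s -> 0 <= q.1 /\ q.2.1 <= q.2.2.
  by move=> qs; apply: hs; rewrite inE qs orbT.
under eq_integral do rewrite big_cons EFinD.
have mind (q : R * R) : measurable_fun (`[1, 2] : set R) (\1_(`[q.1, q.2]) : R -> R).
  exact: measurable_indic.
rewrite ge0_integralD //.
- rewrite big_cons EFinD leeD ?IHs //.
  under eq_integral do rewrite EFinM.
  rewrite ge0_integralZl_EFin //.
  + rewrite EFinM lee_wpmul2l ?lee_fin // integral_indic //.
    apply: le_trans (measureIl _ _ _) _ => //.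
    rewrite /= lebesgue_measure_itv /=; case: ifP => _; first by rewrite -EFinB.
    by rewrite lee_fin subr_ge0.
  + by apply/measurable_EFinP.
- by move=> t _; rewrite lee_fin mulr_ge0.
- by apply/measurable_EFinP; apply: measurable_funM.
- by move=> t _; rewrite lee_fin big_seq sumr_ge0 // => q /hs[q0 _]; rewrite mulr_ge0.
- apply/measurable_EFinP; apply: measurable_sum => q.
  by apply: measurable_funM.
Qed.

End Averaging.

(** * Null sets in coordinate subspaces and their slices *)

Section NullSets.
Context {R : realType} {D : finType}.
Implicit Types (P : {set D}) (b : {ffun D -> R * R}) (N : (D -> R) -> Prop).

(* Covers are sequences of finite lists of boxes, so that boxes can be
   subdivided or discarded without reindexing. *)
Definition null_on P N := forall eps : R, 0 < eps ->
  exists bs : nat -> seq {ffun D -> R * R},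
  [/\ forall k b, b \in bs k -> box_ok b,
      forall x, N x -> exists k, exists2 b, b \in bs k & in_box P b x
    & forall n, \sum_(k < n) \sum_(b <- bs k) box_vol P b <= eps].

Lemma null_on_setT N : lnull N -> null_on [set: D] N.
Proof.
move=> nN eps /nN[lo [hi [lohi [cov sum]]]].
pose b k : {ffun D -> R * R} := [ffun d => (lo k d, hi k d)].
exists (fun k => [:: b k]); split.
- by move=> k c; rewrite inE => /eqP-> d; rewrite ffunE; apply: lohi.
- move=> x /cov[k xk]; exists k; exists (b k); first by rewrite inE.
  by move=> d _; rewrite ffunE; apply: xk.
- move=> n; apply: le_trans (sum n); rewrite le_eqVlt; apply/orP; left; apply/eqP.
  apply: eq_bigr => k _; rewrite big_seq1; apply: eq_big => d; first by rewrite inE.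
  by rewrite /box_width ffunE.
Qed.

Lemma null_on_sub P N N' : (forall x, N' x -> N x) -> null_on P N -> null_on P N'.
Proof.
move=> sub nN eps /nN[bs [ok cov sum]]; exists bs; split=> // x /sub; exact: cov.
Qed.

Lemma null_on_cubes P N d0 : d0 \in P -> null_on P N -> forall eps : R, 0 < eps ->
  exists bs : nat -> seq {ffun D -> R * R},
  [/\ forall k b, b \in bs k -> box_ok b /\
        forall d, d \in P -> box_width b d <= box_width b d0,
      forall x, N x -> exists k, exists2 b, b \in bs k & in_box P b x
    & forall n, \sum_(k < n) \sum_(b <- bs k) box_vol P b <= eps].
Proof.
move=> d0P nN eps eps0.
have e2 : 0 < eps / 2 by rewrite divr_gt0.
have [bs [ok cov sum]] := nN _ e2.
(* The [k]-th list receives a geometric share of [eps / 2] as its subdivision error. *)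
have e0 k : 0 < eps / 2 * 2^-1 ^+ k.+1 by rewrite mulr_gt0 // exprn_gt0 // invr_gt0.
have [bs' ref] := choice (fun k => refined_cube P d0 (bs k) _ d0P (e0 k) (ok k)).
exists bs'; split.
- by move=> k; have [] := ref k.
- move=> x /cov[k [b bk xb]]; exists k; have [_ cov' _] := ref k.
  exact: cov' bk xb.
- move=> n; apply: (@le_trans _ _ (\sum_(k < n)
    (\sum_(b <- bs k) box_vol P b + eps / 2 * 2^-1 ^+ k.+1))).
    by apply: ler_sum => k _; have [] := ref k.
  rewrite big_split /= [leRHS](splitr eps) lerD ?sum // -mulr_sumr.
  by rewrite ler_piMr ?(ltW e2) // sum_pow_half_le1.
Qed.

Definition linear_form (c x : D -> R) : R := \sum_d c d * x d.

Lemma linear_form_box P c b x (h : R) : (forall d, d \notin P -> c d = 0) ->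
  (forall d, d \in P -> box_width b d <= h) -> in_box P b x ->
  `|linear_form c x - linear_form c (fun d => (b d).1)| <= (\sum_d `|c d|) * h.
Proof.
move=> c0 bh xb; rewrite /linear_form -sumrB mulr_suml.
apply: le_trans (ler_norm_sum _ _ _) _; apply: ler_sum => d _.
have [dP|dP] := boolP (d \in P); last by rewrite c0 // !mul0r subrr normr0 mul0r.
rewrite -mulrBr normrM ler_wpM2l //.
have /andP[h1 h2] := xb d dP; have := bh d dP; rewrite /box_width.
by rewrite ger0_norm ?subr_ge0 //; lra.
Qed.

(* On cubes the set of values of the linear form is an interval whose length is
   comparable to the side, so averaging over the level [t] bounds the
   volumes of the cubes which meet a suitable level set, projected along [d0]. *)
Lemma null_on_slice P N d0 (c : D -> R) : d0 \notin P ->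
  (forall d, d \notin d0 |: P -> c d = 0) -> null_on (d0 |: P) N ->
  exists2 t, 1 <= t <= 2 & null_on P (fun x => N x /\ linear_form c x = t).
Proof.
move=> d0P c0 nN.
pose C := 1 + \sum_d `|c d|.
have sc0 : 0 <= \sum_d `|c d| by apply: sumr_ge0.
have C0 : 0 < C by rewrite /C; lra.
(* In the [j]-th cover each box gets weight [2 ^+ j] times its projected volume, on an interval of
   length [2 * C] times its side. The integrals then sum to at most [2 ^+ j.+1 * C] times the cover
   volume, so this volume bound leaves exactly [2^-1 ^+ j.+2]. *)
have e0 j : 0 < (2^-1 : R) ^+ (j.+2 + j.+1) / C.
  by rewrite divr_gt0 // exprn_gt0 // invr_gt0.
have [bs hbs] := choice (fun j => null_on_cubes _ _ d0 (setU11 d0 P) nN _ (e0 j)).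
pose L b := linear_form c (fun d => (b d).1).
(* By [linear_form_box], [J b] contains every value of the form on a near-cube [b]. *)
pose J b : R * R := (L b - C * box_width b d0, L b + C * box_width b d0).
pose st j k := [seq (2 ^+ j * box_vol P b, J b) | b <- bs j k].
pose g j k t : R := \sum_(p <- st j k) p.1 * \1_(`[p.2.1, p.2.2]%classic) t.
pose I j k : R := \sum_(p <- st j k) p.1 * (p.2.2 - p.2.1).
have okst j k p : p \in st j k -> 0 <= p.1 /\ p.2.1 <= p.2.2.
  move=> /mapP[b bj ->] /=; have [/(_ _ _ bj)[ok _] _ _] := hbs j.
  rewrite mulr_ge0 ?exprn_ge0 ?box_vol_ge0 //; split=> //.
  by have := mulr_ge0 (ltW C0) (box_width_ge0 b d0 ok); lra.
have IE j k : I j k = 2 ^+ j.+1 * C * \sum_(b <- bs j k) box_vol (d0 |: P) b.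
  rewrite /I big_map mulr_sumr; apply: eq_bigr => b _ /=.
  by rewrite (box_vol_setD1 _ _ _ (setU11 d0 P)) setU1K // exprS; ring.
have [j k t|j k|j k|j n|t t12 gt] := exists_small_double_series g I.
- rewrite /g big_seq sumr_ge0 // => p /okst[p0 _]; by rewrite mulr_ge0.
- have mind (q : R * R) :
      measurable_fun [set: R]%classic (\1_(`[q.1, q.2]%classic : set R) : R -> R).
    exact: measurable_indic.
  by apply: measurable_sum => p; apply: measurable_funM.
- exact/integral_step_le/okst.
- under eq_bigr do rewrite IE.
  rewrite -mulr_sumr; have [_ _ /(_ n)] := hbs j.
  rewrite ler_pdivlMr // exprD => h.
  rewrite -mulrA -(ler_pM2r (x := 2^-1 ^+ j.+1)) ?exprn_gt0 ?invr_gt0 //.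
  rewrite mulrAC -exprMn divff // expr1n mul1r mulrC.
  exact: h.
exists t => // eps eps0.
have [j jeps] : exists j, (2^-1 : R) ^+ j <= eps.
  pose j := Num.truncn (eps^-1); exists j.
  rewrite exprVn invf_ple ?posrE ?exprn_gt0 //.
  apply: le_trans (ltW (truncnS_gt _)) _.
  by rewrite -natrX ler_nat ltn_expl.
have [okj covj sumj] := hbs j.
pose tJ b := (J b).1 <= t <= (J b).2.
(* Only boxes whose interval contains [t] can meet the level set; at [t] their weighted volumes sum
   to at most 1, so the volumes sum to at most [2^-1 ^+ j]. *)
exists (fun k => [seq b <- bs j k | tJ b]); split.
- by move=> k b; rewrite mem_filter => /andP[_ /okj[]].
- move=> x [/covj[k [b bk xb]] xt]; exists k, b; last first.
    by move=> d dP; apply: xb; rewrite inE dP orbT.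
  rewrite mem_filter bk andbT /tJ /J /=.
  have [okb cb] := okj _ _ bk.
  have := linear_form_box _ _ _ _ _ c0 cb xb; rewrite xt -/(L b).
  have := box_width_ge0 b d0 okb => w0.
  rewrite ler_norml => /andP[h1 h2].
  have CE : C * box_width b d0 = box_width b d0 + (\sum_d `|c d|) * box_width b d0.
    by rewrite /C mulrDl mul1r.
  by rewrite CE; apply/andP; split; lra.
- move=> n; apply: le_trans jeps.
  rewrite -(ler_pM2l (x := 2 ^+ j)) ?exprn_gt0 // -exprMn divff // expr1n.
  apply: le_trans (gt j n); rewrite mulr_sumr ler_sum // => k _.
  rewrite /g big_map big_filter big_mkcond mulr_sumr le_eqVlt; apply/orP; left.
  apply/eqP; apply: eq_bigr => b _; rewrite indicE /= -mulrA.
  rewrite mem_setE in_itv /= -/(tJ b).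
  by case: (tJ b); rewrite ?mulr1 ?mulr0.
Qed.

(** The coordinates in [s] are fixed one at a time, by slicing along the linear form that reads off
    a single coordinate. *)
Lemma null_on_slices P N (s : seq D) : uniq s -> (forall d, d \in s -> d \notin P) ->
  null_on (P :|: [set d in s]) N ->
  exists2 t : D -> R, (forall d, 1 <= t d <= 2) &
    null_on P (fun x => N x /\ forall d, d \in s -> x d = t d).
Proof.
elim: s N => [|d s IHs] N /=.
  move=> _ _ nN; exists (fun=> 1) => [d|]; first by lra.
  have <- : P :|: [set d in [::]] = P by apply/setP => d; rewrite !inE orbF.
  by apply: null_on_sub nN => x [].
move=> /andP[ds us] sP nN.
pose c e : R := (e == d)%:R.
have cE x : linear_form c x = x d.
  rewrite /linear_form (bigD1 d) //= big1 => [|e ed].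
    by rewrite /c eqxx mul1r addr0.
  by rewrite /c (negbTE ed) mul0r.
have [|||td td12 nd] := null_on_slice (P :|: [set e in s]) N d c.
- by rewrite !inE negb_or ds andbT; apply: sP; rewrite mem_head.
- by move=> e; rewrite !inE !negb_or /c => /andP[/negbTE->].
- suff <- : P :|: [set e in d :: s] = d |: (P :|: [set e in s]) by [].
  by apply/setP => e; rewrite !inE orbCA.
have [e es|t t12 nt] := IHs _ us _ nd; first by apply: sP; rewrite inE es orbT.
exists (fun e => if e == d then td else t e) => [e|]; first by case: eqP.
apply: null_on_sub nt => x [Nx xs]; split; last first.
  move=> e es; rewrite xs ?inE ?es ?orbT //.
  by case: eqP => // ed; rewrite -ed es in ds.
by split=> //; rewrite cE xs ?mem_head // eqxx.
Qed.

End NullSets.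

(** * From covers by lists of boxes back to sequences of boxes *)

Lemma sum_nth_le {R : realType} {T : eqType} (F : T -> R) x0 (s : seq T) l :
  (forall x, x \in s -> 0 <= F x) -> F x0 = 0 ->
  \sum_(i < l) F (nth x0 s i) <= \sum_(x <- s) F x.
Proof.
move=> + Fx0; elim: s l => [|x s IHs] l F0.
  by rewrite big1 ?big_nil // => i _; rewrite nth_nil.
case: l => [|l]; first by rewrite big_ord0 big_seq sumr_ge0.
rewrite big_ord_recl big_cons /= lerD2l; apply: IHs => y ys.
by apply: F0; rewrite inE ys orbT.
Qed.

(** The finitely many codes below [n] decode to pairs inside some square, and distinct codes give
    distinct pairs. *)
Lemma sum_unpickle_le {R : realType} (F : nat * nat -> R) n : (forall p, 0 <= F p) ->
  exists m, \sum_(h < n) (if pickle_inv h is Some p then F p else 0) <=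
    \sum_(k < m) \sum_(i < m) F (val k, val i).
Proof.
move=> F0; pose u h : nat * nat := odflt (0, 0)%N (pickle_inv h).
(* One more than the sum of all decoded coordinates, hence larger than each of them. *)
pose m := (\sum_(h < n) ((u h).1 + (u h).2)).+1; exists m.
rewrite pair_big_dep /=.
apply: (@le_trans _ _ (\sum_(h < n) \sum_(p : 'I_m * 'I_m)
    if pickle (val p.1, val p.2) == h then F (val p.1, val p.2) else 0)); last first.
  rewrite exchange_big /=; apply: ler_sum => p _; rewrite -big_mkcond /=.
  have [plt|pge] := ltnP (pickle (val p.1, val p.2)) n.
    rewrite (bigD1 (Ordinal plt)) //= big1 ?addr0 // => h /andP[/eqP hp].
    by rewrite -val_eqE /= hp eqxx.
  by rewrite big1 // => h /eqP ph; move: (ltn_ord h); rewrite -ph ltnNge pge.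
apply: ler_sum => h _; case E : (pickle_inv h) => [p|]; last first.
  by apply: sumr_ge0 => p _; case: ifP.
have le_m : ((u h).1 + (u h).2 < m)%N by rewrite ltnS (bigD1 h) //= leq_addr.
have uE : u h = p by rewrite /u E.
rewrite uE in le_m.
have p1 : (p.1 < m)%N := leq_ltn_trans (leq_addr _ _) le_m.
have p2 : (p.2 < m)%N := leq_ltn_trans (leq_addl _ _) le_m.
rewrite (bigD1 (Ordinal p1, Ordinal p2)) //= -surjective_pairing.
have -> : pickle p == h.
  by have := @pickle_invK (nat * nat)%type h; rewrite E /= => ->.
by rewrite lerDl; apply: sumr_ge0 => q _; case: ifP.
Qed.

(** [null_on P N] constrains only the projection of [N] to [P], so the coordinates of [x] outside
    [P] may be existentially quantified. Passing from [x] to [y] divides every volume by the product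
    of the [kap e]. *)
Lemma null_on_lnull {R : realType} {D E : finType} (P : {set D}) (f : E -> D)
    (kap : E -> R) (N : (D -> R) -> Prop) : (0 < #|E|)%N ->
  injective f -> P = [set f e | e in E] -> (forall e, 0 < kap e) ->
  null_on P N ->
  lnull (fun y : E -> R => exists2 x, N x & forall e, x (f e) = kap e * y e).
Proof.
move=> /card_gt0P[e0 _] finj PE kap0 nN eps eps0.
pose K := \prod_e kap e.
have K0 : 0 < K by apply: prodr_gt0.
have [bs [ok cov sum]] := nN _ (mulr_gt0 K0 eps0).
(* Padding for indices that code no box. Its volume is 0 because [E] is nonempty; an empty product
   would be 1. *)
pose b0 : {ffun D -> R * R} := [ffun => (0, 0)].
pose bn (n : nat) : {ffun D -> R * R} :=
  if @pickle_inv (nat * nat)%type n is Some (k, i) then nth b0 (bs k) i else b0.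
have okb0 : box_ok b0 by move=> d; rewrite ffunE.
have okn k i : box_ok (nth b0 (bs k) i).
  have [ilt|ige] := ltnP i (size (bs k)); first exact: ok (mem_nth _ ilt).
  by rewrite nth_default.
have okbn n : box_ok (bn n) by rewrite /bn; case: pickle_inv => [[k i]|].
have volE b : box_vol P b = \prod_e box_width b (f e).
  by rewrite /box_vol PE big_imset /=; [apply: eq_bigl|move=> ? ? _ _ /finj].
have vb0 : box_vol P b0 = 0.
  by rewrite volE (bigD1 e0) //= /box_width ffunE subrr mul0r.
exists (fun n e => (bn n (f e)).1 / kap e), (fun n e => (bn n (f e)).2 / kap e).
split=> [n e|]; first by rewrite ler_pM2r ?invr_gt0 //; apply: okbn.
split=> [y [x /cov[k [b bk xb]] xy]|n].
  exists (pickle (k, index b (bs k))) => e.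
  rewrite /bn pickleK_inv nth_index // ler_pdivrMr // ler_pdivlMr //.
  rewrite mulrC -xy; apply: xb; rewrite PE; exact: imset_f.
have -> : \sum_(k < n) \prod_e ((bn k (f e)).2 / kap e - (bn k (f e)).1 / kap e)
    = (\sum_(k < n) box_vol P (bn k)) / K.
  rewrite mulr_suml; apply: eq_bigr => k _.
  rewrite volE -prodf_div; apply: eq_bigr => e _.
  by rewrite -mulrBl.
rewrite ler_pdivrMr // mulrC.
have F0 p : 0 <= box_vol P (nth b0 (bs p.1) p.2) by apply: box_vol_ge0.
have [m le_m] := sum_unpickle_le (fun p => box_vol P (nth b0 (bs p.1) p.2)) n F0.
apply: le_trans (le_trans _ (le_trans le_m _)) (sum m).
  by apply: ler_sum => h _; rewrite /bn; case: pickle_inv => [[k i]|] //=; rewrite vb0.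
apply: ler_sum => k _.
by apply: (sum_nth_le (box_vol P) b0 (bs k) m) => // b /ok; apply: box_vol_ge0.
Qed.

(** * Marginals without reference to the order of the modes *)

Lemma pctf_marginal_prod (R : realType) (I M rk : nat) (lam : 'I_rk -> R)
    (a : 'I_M -> 'I_rk -> 'I_I -> R) (S : {set 'I_M}) x y z (F : 'I_M -> 'I_I) :
  enum S = [:: x; y; z] ->
  pctf_marginal lam a S (F x) (F y) (F z) =
    \sum_(r < rk) lam r * \prod_(m in S) a m r (F m).
Proof.
move=> ES; rewrite /pctf_marginal ES; apply: eq_bigr => r _.
by rewrite -big_enum /= ES !big_cons big_nil mulr1 !mulrA.
Qed.

(** [enum] may list the triplet in another order than [j], [k], [l]. Products over the set, with the
    index of each mode given by a function [F], do not see the order. *)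
Lemma pctf_same_image_triple (R : realType) (I M rk : nat) (T : {set {set 'I_M}})
    (lam lam' : 'I_rk -> R) (a a' : 'I_M -> 'I_rk -> 'I_I -> R) j k l :
  pctf_same_image T lam a lam' a' -> [set j; k; l] \in T -> uniq [:: j; k; l] ->
  forall i1 i2 i3,
    \sum_(r < rk) lam r * a j r i1 * a k r i2 * a l r i3 =
    \sum_(r < rk) lam' r * a' j r i1 * a' k r i2 * a' l r i3.
Proof.
move=> same ST u i1 i2 i3.
have pS : perm_eq (enum [set j; k; l]) [:: j; k; l].
  by apply: uniq_perm; rewrite ?enum_uniq // => x; rewrite mem_enum !inE orbA.
pose F m := if m == j then i1 else if m == k then i2 else i3.
have [Fj Fk Fl] : [/\ F j = i1, F k = i2 & F l = i3].
  move: u; rewrite /= !inE negb_or !andbT => /andP[/andP[jk jl] kl].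
  by rewrite /F !eqxx [k == j]eq_sym [l == j]eq_sym [l == k]eq_sym
     (negbTE jk) (negbTE jl) (negbTE kl).
have E (b : 'I_M -> 'I_rk -> 'I_I -> R) (u0 : 'I_rk -> R) :
    \sum_(r < rk) u0 r * b j r i1 * b k r i2 * b l r i3 =
    \sum_(r < rk) u0 r * \prod_(m in [set j; k; l]) b m r (F m).
  apply: eq_bigr => r _; rewrite -big_enum (perm_big _ pS) /= !big_cons big_nil.
  by rewrite mulr1 Fj Fk Fl !mulrA.
rewrite !E; have /perm_size := pS.
case ES : (enum _) => [|x [|y [|z []]]] // _.
by rewrite -!(@pctf_marginal_prod _ _ _ _ _ _ _ _ _ _ _ ES) same.
Qed.

(** * Stacked factors and the CP equations they satisfy *)

Section Stacking.
Context {R : realType} {I M rk : nat}.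
Implicit Types (A : {set 'I_M}) (a : 'I_M -> 'I_rk -> 'I_I -> R)
  (p : option ('I_M * 'I_I.-1)).

(* [Some (m, k)] labels the row holding the k-th free entry of the mode-m
   factor and [None] the row of ones. *)
Definition stack_rows A : {set option ('I_M * 'I_I.-1)} :=
  [set p | if p is Some q then q.1 \in A else true].

Definition stack_entry a r p : R :=
  if p is Some q then a q.1 r (widen_ord (leq_pred I) q.2) else 1.

Lemma card_stack_rows A : #|stack_rows A| = ((I - 1) * #|A| + 1)%N.
Proof.
have -> : stack_rows A = None |: Some @: setX A [set: 'I_I.-1].
  apply/setP => -[[m k]|]; rewrite !inE /=; last by [].
  by rewrite (mem_imset _ _ (@Some_inj _)) !inE andbT.
rewrite cardsU1 card_imset ?cardsX ?cardsT ?card_ord; last exact: Some_inj.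
have -> : (None \notin [set Some x | x in setX A [set: 'I_I.-1]]).
  by apply/imsetP => -[].
by rewrite add1n addn1 mulnC subn1.
Qed.

(** [g] is total, with a default value off [stack_rows A], hence the restricted cancellation. *)
Lemma stack_labelling A :
  exists (f : 'I_((I - 1) * #|A| + 1) -> option ('I_M * 'I_I.-1)) g,
  [/\ cancel f g, forall i, f i \in stack_rows A &
      {in stack_rows A, cancel g f}].
Proof.
have E := card_stack_rows A.
have N0 : None \in stack_rows A by rewrite inE.
exists (fun i => enum_val (cast_ord (esym E) i)).
exists (fun p => cast_ord E (enum_rank_in N0 p)); split.
- by move=> i; rewrite enum_valK_in cast_ordKV.
- by move=> i; apply: enum_valP.
- by move=> p pA; rewrite cast_ordK enum_rankK_in.
Qed.

(** The equation for the row of ones is the sum over [i] of those for mode [m0], whose factors sum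
    to 1. The weights [X] are meant to absorb the other two factors of a CP term. *)
Lemma sum_stack_entry A (X X' : 'I_rk -> R) a a' m0 p :
  m0 \in A -> p \in stack_rows A ->
  (forall r, \sum_i a m0 r i = 1) -> (forall r, \sum_i a' m0 r i = 1) ->
  (forall m, m \in A -> forall i,
     \sum_r X r * a m r i = \sum_r X' r * a' m r i) ->
  \sum_r X r * stack_entry a r p = \sum_r X' r * stack_entry a' r p.
Proof.
move=> m0A; case: p => [[m k]|]; rewrite inE /=; first by move=> mA _ _ ->.
move=> _ a1 a1' eqX.
have E (Y : 'I_rk -> R) (b : 'I_M -> 'I_rk -> 'I_I -> R) :
    (forall r, \sum_i b m0 r i = 1) ->
    \sum_r Y r * 1 = \sum_i \sum_r Y r * b m0 r i.
  by move=> b1; rewrite exchange_big /=; apply: eq_bigr => r _; rewrite -mulr_sumr b1.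
by rewrite (E _ _ a1) (E _ _ a1'); apply: eq_bigr => i _; apply: eqX.
Qed.

Lemma simplex_eq_proj (u v : 'I_I -> R) : (0 < I)%N ->
  \sum_i u i = 1 -> \sum_i v i = 1 ->
  (forall k, u (widen_ord (leq_pred I) k) = v (widen_ord (leq_pred I) k)) -> u =1 v.
Proof.
case: I u v => // n u v _; rewrite !big_ord_recr /= => u1 v1 uv.
have uvw (k : 'I_n) : u (widen_ord (leqnSn n) k) = v (widen_ord (leqnSn n) k).
  by have := uv k; congr (u _ = v _); apply: val_inj.
have E : \sum_(k < n) u (widen_ord (leqnSn n) k) =
    \sum_(k < n) v (widen_ord (leqnSn n) k).
  by apply: eq_bigr => k _.
have uvm : u ord_max = v ord_max.
  apply: (addrI (\sum_(k < n) u (widen_ord (leqnSn n) k))).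
  by rewrite u1 E v1.
move=> i; have [ilt|ige] := ltnP i n.
  by have := uvw (Ordinal ilt); congr (u _ = v _); apply: val_inj.
have -> // : i = ord_max.
by apply: val_inj => /=; apply/eqP; rewrite eqn_leq ige -ltnS ltn_ord.
Qed.

End Stacking.

(** [sum_stack_entry] is applied once per class, reducing stacked rows to entries of single modes
    [j], [k], [l]; disjointness makes these a genuine triplet of the coupling. *)
Lemma cartesian_coupling_stack_eq (R : realType) (I M rk : nat)
    (M1 M2 M3 : {set 'I_M}) (lam lam' : 'I_rk -> R)
    (a a' : 'I_M -> 'I_rk -> 'I_I -> R) :
  M1 != set0 -> M2 != set0 -> M3 != set0 ->
  [disjoint M1 & M2] -> [disjoint M1 & M3] -> [disjoint M2 & M3] ->
  (forall m r, \sum_(i < I) a m r i = 1) ->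
  (forall m r, \sum_(i < I) a' m r i = 1) ->
  pctf_same_image (cartesian_coupling M1 M2 M3) lam a lam' a' ->
  forall p1 p2 p3, p1 \in stack_rows M1 -> p2 \in stack_rows M2 ->
    p3 \in stack_rows M3 ->
  \sum_r lam r * stack_entry a r p1 * stack_entry a r p2 * stack_entry a r p3 =
  \sum_r lam' r * stack_entry a' r p1 * stack_entry a' r p2 * stack_entry a' r p3.
Proof.
move=> /set0Pn[j0 j0M] /set0Pn[k0 k0M] /set0Pn[l0 l0M] d12 d13 d23 a1 a1' same.
move=> p1 p2 p3 p1M p2M p3M.
apply: (sum_stack_entry M3 _ _ a a' l0) => // l lM i3.
transitivity (\sum_r (lam r * stack_entry a r p1 * a l r i3) * stack_entry a r p2).
  by apply: eq_bigr => r _; rewrite mulrAC.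
transitivity (\sum_r (lam' r * stack_entry a' r p1 * a' l r i3) * stack_entry a' r p2);
  last by apply: eq_bigr => r _; rewrite mulrAC.
apply: (sum_stack_entry M2 _ _ a a' k0) => // k kM i2.
transitivity (\sum_r (lam r * a k r i2 * a l r i3) * stack_entry a r p1).
  by apply: eq_bigr => r _; ring.
transitivity (\sum_r (lam' r * a' k r i2 * a' l r i3) * stack_entry a' r p1);
  last by apply: eq_bigr => r _; ring.
apply: (sum_stack_entry M1 _ _ a a' j0) => // j jM i1.
transitivity (\sum_r lam r * a j r i1 * a k r i2 * a l r i3).
  by apply: eq_bigr => r _; ring.
transitivity (\sum_r lam' r * a' j r i1 * a' k r i2 * a' l r i3);
  last by apply: eq_bigr => r _; ring.
apply: pctf_same_image_triple same _ _ i1 i2 i3.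
  rewrite inE; apply/existsP; exists j; rewrite jM; apply/existsP; exists k.
  by rewrite kM; apply/existsP; exists l; rewrite lM /=.
rewrite /= !inE negb_or !andbT; apply/andP; split; [apply/andP; split|].
- by apply: contraTneq jM => ->; rewrite (disjointFl d12).
- by apply: contraTneq jM => ->; rewrite (disjointFl d13).
- by apply: contraTneq kM => ->; rewrite (disjointFl d23).
Qed.

(** * Slicing the exceptional set and transferring identifiability *)

Theorem mainTheorem1 (R : realType) (I M rk : nat) (M1 M2 M3 : {set 'I_M}) :
  (2 <= I)%N -> (3 < M)%N -> (1 <= rk)%N ->
  M1 != set0 -> M2 != set0 -> M3 != set0 ->
  [disjoint M1 & M2] -> [disjoint M1 & M3] -> [disjoint M2 & M3] ->
  M1 :|: M2 :|: M3 = setT ->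
  cp_identifiable R ((I - 1) * #|M1| + 1) ((I - 1) * #|M2| + 1)
                    ((I - 1) * #|M3| + 1) rk ->
  pctf_identifiable R I rk (cartesian_coupling M1 M2 M3).
Proof.
move=> I2 M3lt rk1 n1 n2 n3 d12 d13 d23 MU [N [nN cpN]].
have M3E m : m \notin M1 -> m \notin M2 -> m \in M3.
  move=> m1 m2; have : m \in M1 :|: M2 :|: M3 by rewrite MU inE.
  by rewrite !inE (negbTE m1) (negbTE m2).
have [f1 [g1 [fK1 fM1 gK1]]] := @stack_labelling I M M1.
have [f2 [g2 [fK2 fM2 gK2]]] := @stack_labelling I M M2.
have [f3 [g3 [fK3 fM3 gK3]]] := @stack_labelling I M M3.
have N0 (A : {set 'I_M}) : None \in @stack_rows I M A by rewrite inE.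
set D := cp_coord _ _ _ _ in N nN cpN.
pose sliced (d : D) : bool := match d with
  | inl _ => false
  | inr (inl (i, _)) => f1 i == None
  | inr (inr (inl (i, _))) => f2 i == None
  | inr (inr (inr (i, _))) => f3 i == None
  end.
have rkp : (rk.-1 < rk)%N by rewrite prednK.
(* The last weight, which [pctf_coord] drops, is the coordinate eliminated by the linear
   equation. *)
pose d0 : D := inl (Ordinal rkp).
pose P0 : {set D} := [set d | ~~ sliced d].
pose s : seq D := [seq d <- enum D | sliced d].
have memS d : (d \in s) = sliced d by rewrite mem_filter mem_enum andbT.
have [||| t t12 nt] := null_on_slices P0 N s.
- by rewrite filter_uniq // enum_uniq.
- by move=> d; rewrite memS inE negbK.
- suff -> : P0 :|: [set d in s] = setT by apply: null_on_setT.
  by apply/setP => d; rewrite !inE memS orNb.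
have tgt0 d : 0 < t d by apply: lt_le_trans (andP (t12 d)).1.
pose al r := t (inr (inl (g1 None, r)) : D).
pose be r := t (inr (inr (inl (g2 None, r))) : D).
pose ga r := t (inr (inr (inr (g3 None, r))) : D).
have w0 r : 0 < al r * be r * ga r by rewrite !mulr_gt0 ?tgt0.
pose c (d : D) : R := if d is inl r then al r * be r * ga r else 0.
have d0P0 : d0 |: (P0 :\ d0) = P0 by rewrite setD1K // inE.
rewrite -d0P0 in nt.
have [||tau tau12 ntau] := null_on_slice _ _ d0 c _ _ nt.
- by rewrite !inE eqxx.
- by rewrite d0P0 => -[r|d //]; rewrite inE.
have tau0 : 0 < tau by apply: lt_le_trans (andP tau12).1.
(* [j] places the affine coordinates of Theta among the CP coordinates, and [kap] is the factor by
   which the rescaling onto the slice multiplies each. *)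
pose j (e : pctf_coord I M rk) : D := match e with
  | inl r => inl (widen_ord (leq_pred rk) r)
  | inr (m, r, k) =>
      if m \in M1 then inr (inl (g1 (Some (m, k)), r))
      else if m \in M2 then inr (inr (inl (g2 (Some (m, k)), r)))
      else inr (inr (inr (g3 (Some (m, k)), r)))
  end.
pose kap (e : pctf_coord I M rk) : R := match e with
  | inl r => let r' := widen_ord (leq_pred rk) r in tau / (al r' * be r' * ga r')
  | inr (m, r, _) => if m \in M1 then al r else if m \in M2 then be r else ga r
  end.
have Sin (A : {set 'I_M}) m (k : 'I_I.-1) : m \in A -> Some (m, k) \in stack_rows A.
  by rewrite inE.
have jinj : injective j.
  move=> [r|[[m r] k]] [r'|[[m' r'] k']] //=.
  - by case=> /val_inj->.
  - by case: ifP => // _; case: ifP.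
  - by case: ifP => // _; case: ifP.
  have [m1|m1] := boolP (m \in M1); have [m1'|m1'] := boolP (m' \in M1).
  - by case=> /(congr1 f1) + ->; rewrite !gK1 ?Sin // => -[-> ->].
  - by case: ifP.
  - by case: ifP.
  have [m2|m2] := boolP (m \in M2); have [m2'|m2'] := boolP (m' \in M2) => //.
  - by case=> /(congr1 f2) + ->; rewrite !gK2 ?Sin // => -[-> ->].
  - by case=> /(congr1 f3) + ->; rewrite !gK3 ?Sin ?M3E // => -[-> ->].
(* The coordinates left free by the slice are exactly those of Theta. *)
have PE : P0 :\ d0 = [set j e | e in pctf_coord I M rk].
  apply/setP => d; rewrite !inE; apply/andP/imsetP; last first.
    move=> [[r|[[m r] k]] _ ->] /=.
      by split=> //; apply/eqP => -[] /eqP; rewrite (ltn_eqF (ltn_ord r)).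
    case: ifP => [m1|/negbT m1]; first by rewrite /= gK1 ?Sin.
    case: ifP => [m2|/negbT m2]; first by rewrite /= gK2 ?Sin.
    by rewrite /= gK3 ?Sin ?M3E.
  move=> []; case: d => [r rd0 _|[[i r]|[[i r]|[i r]]] _ /=].
  - have rlt : (r < rk.-1)%N.
      rewrite ltn_neqAle -ltnS prednK // ltn_ord andbT.
      by apply: contraNneq rd0 => rE; apply/eqP; congr inl; apply: val_inj.
    by exists (inl (Ordinal rlt)) => //=; congr inl; apply: val_inj.
  - case E : (f1 i) => [[m k]|//] _; have := fM1 i; rewrite E inE /= => mM.
    by exists (inr (m, r, k)) => //=; rewrite mM -E fK1.
  - case E : (f2 i) => [[m k]|//] _; have := fM2 i; rewrite E inE /= => mM.
    by exists (inr (m, r, k)) => //=; rewrite (disjointFl d12) // mM -E fK2.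
  - case E : (f3 i) => [[m k]|//] _; have := fM3 i; rewrite E inE /= => mM.
    exists (inr (m, r, k)) => //=.
    by rewrite (disjointFl d13) // (disjointFl d23) // -E fK3.
have kap0 e : 0 < kap e.
  case: e => [r|[[m r] k]] /=; first by rewrite divr_gt0.
  by case: ifP => _; [|case: ifP => _]; apply: tgt0.
have cardE : (0 < #|pctf_coord I M rk|)%N.
  have M0 : (0 < M)%N by apply: leq_ltn_trans M3lt.
  have I0 : (0 < I.-1)%N by rewrite -subn1 subn_gt0.
  by rewrite card_sum !card_prod !card_ord addn_gt0 !muln_gt0 M0 rk1 I0 orbT.
eexists; split; first exact: null_on_lnull cardE jinj PE kap0 ntau.
move=> lam a [_ [lam1 [_ a1]]] notN lam' a' [_ [_ [_ a1']]] same.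
(* The rescaled parameters: their last rows are [al], [be], [ga], the linear form takes the value
   [tau] at them, and each rank-one term is multiplied by [tau]. *)
pose L r : R := tau * lam r / (al r * be r * ga r).
pose A i r : R := al r * stack_entry a r (f1 i).
pose B i r : R := be r * stack_entry a r (f2 i).
pose C i r : R := ga r * stack_entry a r (f3 i).
have {}notN : ~ N (cp_encode L A B C).
  apply: contra_not notN => Ncp; exists (cp_encode L A B C); last first.
    case=> [r|[[m r] k]] /=; first by rewrite /L; ring.
    case: ifP => [m1|/negbT m1] /=; first by rewrite /A gK1 ?Sin.
    case: ifP => [m2|/negbT m2] /=; first by rewrite /B gK2 ?Sin.
    by rewrite /C gK3 ?Sin ?M3E.
  split; last first.
    rewrite /linear_form big_sumType /= [X in _ + X]big1 ?addr0; last first.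
      by move=> ? _; rewrite mul0r.
    rewrite -[RHS]mulr1 -lam1 mulr_sumr; apply: eq_bigr => r _.
    by rewrite /L mulrC divfK // gt_eqF.
  split=> // -[r|[[i r]|[[i r]|[i r]]]]; rewrite memS //= => /eqP E.
  - by rewrite /A /al -E fK1 E mulr1.
  - by rewrite /B /be -E fK2 E mulr1.
  - by rewrite /C /ga -E fK3 E mulr1.
(* The competitor may be any decomposition, so it need not lie on the slice: its weights are merely
   multiplied by [tau] to match the tensor. *)
have [|sg [c0 [c1 [c2 [c3 rel]]]]] := cpN L A B C notN (fun r => tau * lam' r)
    (fun i r => stack_entry a' r (f1 i)) (fun i r => stack_entry a' r (f2 i))
    (fun i r => stack_entry a' r (f3 i)).
  move=> i1 i2 i3; rewrite /cp_tensor.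
  have := cartesian_coupling_stack_eq _ _ _ _ _ _ _ _ _ _ _ n1 n2 n3 d12 d13 d23
    a1 a1' same _ _ _ (fM1 i1) (fM2 i2) (fM3 i3).
  move=> /(congr1 ( *%R tau)); rewrite !mulr_sumr => E.
  transitivity (\sum_r tau * (lam' r * stack_entry a' r (f1 i1) *
     stack_entry a' r (f2 i2) * stack_entry a' r (f3 i3))).
    by apply: eq_bigr => r _; rewrite !mulrA.
  rewrite -E; apply: eq_bigr => r _; rewrite /L /A /B /C.
  by field; rewrite !gt_eqF ?tgt0.
have lam_a r : lam' (sg r) = lam r /\ forall m i, a' m (sg r) i = a m r i.
  have [cE [LE [AE [BE CE]]]] := rel r.
  (* Comparing the rows of ones determines the scalings, which therefore undo [al], [be], [ga]. *)
  have c1E : c1 r * al r = 1 by have := AE (g1 None); rewrite /A gK1 //= mulr1 => <-.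
  have c2E : c2 r * be r = 1 by have := BE (g2 None); rewrite /B gK2 //= mulr1 => <-.
  have c3E : c3 r * ga r = 1 by have := CE (g3 None); rewrite /C gK3 //= mulr1 => <-.
  split.
    apply: (mulfI (lt0r_neq0 tau0)); rewrite LE /L.
    have -> : c0 r = al r * be r * ga r.
      transitivity (c0 r * (c1 r * al r) * (c2 r * be r) * (c3 r * ga r)).
        by rewrite c1E c2E c3E !mulr1.
      rewrite -[RHS]mul1r -cE; ring.
    by rewrite mulrC divfK // gt_eqF.
  move=> m; apply: simplex_eq_proj => // [|k]; first exact: ltnW.
  have [m1|m1] := boolP (m \in M1).
    by have := AE (g1 (Some (m, k))); rewrite /A gK1 ?Sin //= mulrA c1E mul1r.
  have [m2|m2] := boolP (m \in M2).
    by have := BE (g2 (Some (m, k))); rewrite /B gK2 ?Sin //= mulrA c2E mul1r.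
  by have := CE (g3 (Some (m, k))); rewrite /C gK3 ?Sin ?M3E //= mulrA c3E mul1r.
(* The CP relation permutes the index of the primed parameters, the conclusion that of the unprimed
   ones. *)
exists (sg^-1)%g => r; have [lamE aE] := lam_a ((sg^-1)%g r).
by rewrite permKV in lamE aE; split.
Qed.
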